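(* There exist constants $K<\infty$ and $\kappa\in(0,1)$, not depending on the Markov chain, such that the following holds. Let $X$ be an irreducible discrete-time Markov chain on a finite state space $\mathcal X$, let $(x_0,G)$ be a reference pair with $T:=\mathbb E\,\tau^{x_0}_G$, suppose that $(x_0,G)$ satisfies $Rec(R,r)$ with $0<R<T$, and set $\epsilon:=R/T$. If $\epsilon\le\kappa$, $r\le\kappa$, and $\eta\in(0,1)$ is such that $\epsilon/\eta\le\kappa$ and $r/\eta\le\kappa$, then $\tau^{x_0}_G$ has early exponential behaviour $EE(\eta T,\alpha)$ with $$\alpha=K\Bigl(\frac{\epsilon}{\eta}+\frac r\eta\Bigr)$$ (that is, $\alpha=O(\epsilon/\eta)+O(r/\eta)$). For instance, for every $\gamma<1$, the property holds for $\eta=[\max\{\epsilon,r\}]^{\gamma}$, provided this $\eta$ lies in $(0,1)$ and $\epsilon,r$ are small enough (depending on $\gamma$).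
   Context: $X^x=(X^x_t)_{t\in\mathbb N}$ denotes the chain started at $x\in\mathcal X$. For $F\subset\mathcal X$, $\tau^x_F=\inf\{t\ge0:X^x_t\in F\}$. A reference pair $(x_0,G)$ consists of $x_0\in\mathcal X$ and a nonempty $G\subset\mathcal X$; $\{x_0,G\}$ denotes $\{x_0\}\cup G$. No reversibility is assumed. For $R>0$ (recurrence time) and $r\in(0,1)$ (recurrence error), $(x_0,G)$ satisfies $Rec(R,r)$ if $\sup_{x\in\mathcal X}\mathbb P(\tau^x_{\{x_0,G\}}>R)\le r$. Early exponential behaviour: a random variable $\theta$ has $EE(S,\alpha)$ (early exponential behaviour at scale $S\le\mathbb E\theta$ with rate $\alpha$) if for every integer $k\ge0$ with $kS\le\mathbb E\theta$, $$\Bigl|\frac{\mathbb P(\theta\in(kS,(k+1)S])}{\mathbb P(\theta>S)^k\,\mathbb P(\theta\le S)}-1\Bigr|<\alpha.$$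
   Formalization: The recurrence time is required to satisfy R ≥ 1 (at least one step) instead of R > 0; for real 0 < R < 1 the claim fails, e.g. for a two-state chain {x0,g} with G={g}, jump probability q, ηT = 1.5 and R, r → 0. *)

(* Defs.v *)
From HB Require Import structures.
From mathcomp Require Import all_boot all_order all_algebra.
From mathcomp Require Import all_classical all_reals all_analysis.

Set Implicit Arguments.
Unset Strict Implicit.
Unset Printing Implicit Defensive.

Import Order.TTheory GRing.Theory Num.Theory.

Local Open Scope classical_set_scope.
Local Open Scope ring_scope.

Definition stochastic (R : realType) (St : finType) (p : St -> St -> R) : Prop :=
  (forall x y, 0 <= p x y) /\ (forall x, \sum_(y : St) p x y = 1).

Fixpoint nstep (R : realType) (St : finType) (p : St -> St -> R) (n : nat)
    (x y : St) : R :=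
  if n is m.+1 then \sum_(z : St) p x z * nstep p m z y else (x == y)%:R.

Definition irreducible (R : realType) (St : finType) (p : St -> St -> R) : Prop :=
  forall x y, exists n, 0 < nstep p n x y.

(* Real-valued probability of an event and conditional probability of A given
   B; the latter is meaningful only when B has positive probability. *)
Definition prob (R : realType) (d : measure_display) (Omega : measurableType d)
    (P : probability Omega R) (A : set Omega) : R :=
  fine (P A).

Definition condprob (R : realType) (d : measure_display)
    (Omega : measurableType d) (P : probability Omega R) (A B : set Omega) : R :=
  prob P (A `&` B) / prob P B.

(* The event {Z_0 = s 0, ..., Z_n = s n}; values of s beyond n are ignored. *)
Definition history (Omega : Type) (St : finType) (Z : nat -> Omega -> St)
    (s : nat -> St) (n : nat) : set Omega :=
  [set w | forall i, (i <= n)%N -> Z i w = s i].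

Definition markov_chain_from (R : realType) (d : measure_display)
    (Omega : measurableType d) (P : probability Omega R) (St : finType)
    (p : St -> St -> R) (x : St) (Z : nat -> Omega -> St) : Prop :=
  [/\ forall t y, measurable (Z t @^-1` [set y]),
      prob P (Z 0%N @^-1` [set x]) = 1
    & forall (n : nat) (s : nat -> St) (y : St),
        0 < prob P (history Z s n) ->
        condprob P (Z n.+1 @^-1` [set y]) (history Z s n) = p (s n) y].

(* An irreducible chain with transition matrix p; X x is its realization
   started at x. *)
Definition irreducible_markov_chain (R : realType) (d : measure_display)
    (Omega : measurableType d) (P : probability Omega R) (St : finType)
    (p : St -> St -> R) (X : St -> nat -> Omega -> St) : Prop :=
  [/\ stochastic p, irreducible p & forall x, markov_chain_from P p x (X x)].

(* The value is +oo when F is never visited. *)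
Definition hitting_time (R : realType) (Omega : Type) (St : finType)
    (Z : nat -> Omega -> St) (F : set St) (w : Omega) : \bar R :=
  ereal_inf [set (t%:R)%:E | t in [set t : nat | F (Z t w)]].

(* The library's expectation is for real-valued variables; here the variable
   may take the value +oo. *)
Definition mean (R : realType) (d : measure_display) (Omega : measurableType d)
    (P : probability Omega R) (theta : Omega -> \bar R) : \bar R :=
  (\int[P]_w theta w)%E.

(* rho is a time of a discrete-time chain, so a positive rho is at least one
   step; Rec rho r is the same condition as Rec (floor rho) r. With rho < 1 it
   would only say that x0 |` G is the whole space while rho / T could be made
   arbitrarily small, and intervals of length eta * T shorter than a step would
   then be admissible scales. *)
Definition Rec (R : realType) (d : measure_display) (Omega : measurableType d)
    (P : probability Omega R) (St : finType) (X : St -> nat -> Omega -> St)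
    (x0 : St) (G : set St) (rho r : R) : Prop :=
  (ereal_sup [set P [set w | rho%:E < hitting_time R (X x) (x0 |` G) w]
             | x in [set: St]] <= r%:E)%E.

(* The denominator is required to be nonzero, so that the quotient never takes
   the conventional value of a division by zero. *)
Definition early_exponential (R : realType) (d : measure_display)
    (Omega : measurableType d) (P : probability Omega R)
    (theta : Omega -> \bar R) (S alpha : R) : Prop :=
  (S%:E <= mean P theta)%E /\
  forall k : nat, ((k%:R * S)%:E <= mean P theta)%E ->
    let den := prob P [set w | (S%:E < theta w)%E] ^+ k
               * prob P [set w | (theta w <= S%:E)%E] in
    den != 0 /\
    `| prob P [set w | ((k%:R * S)%:E < theta w <= (k.+1%:R * S)%:E)%E] / den
       - 1 | < alpha.

(* Main.v *)
Require Import Defs.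
From HB Require Import structures.
From mathcomp Require Import all_boot all_order all_algebra.
From mathcomp Require Import all_classical all_reals all_analysis.
From mathcomp Require Import ring lra zify.

(** Write [f n] for the probability that the chain started at [x0] avoids [G]
    up to time [n], let [N] be the integer part of the recurrence time,
    [e = rho / T] and [E = e + r]. The proof rests on two inequalities obtained
    by restarting the chain at the first time after [t] at which it lies in
    [x0 |` G]; this takes at most [N] steps outside an event of probability
    [r], and if the chain has not met [G] by then it starts afresh from [x0]:
    - [f (t + s) <= f t * (r + f (s - N))] ([tail_le_renew]),
    - [f (t + s) >= (f (t + N) - r * f t) * f s] ([tail_ge_renew]).

    Everything else is real analysis on [f] and the identity
    [T = \sum_n f n]. The first inequality says that [f] decays by a factor
    [r + f (s - N)] every [s] steps, so that [T] is at most
    [s / (1 - r - f (s - N))]; hence [1 - f s <= E + s / T]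
    ([tail_ge_linear]). With [s = 2 N] a fresh excursion from [x0] is unlikely
    to meet [G] within [2 N] steps, and the second inequality propagates this
    along the whole trajectory: [f (t + N) >= (1 - 8 E) f t]
    ([hazard_N_small]). Waiting [N] steps therefore costs a factor
    [1 - O(E)], and the two restarting inequalities become the approximate
    memorylessness [f (t + s) = f t * (f s + O(E))] ([tail_supermult],
    [tail_submult]).

    Take [S = eta * T] and [q = f S]. By memorylessness [f] loses a factor
    [q * (1 + O(E))] on every window of length [S]; since there are at most
    [1 / eta] windows before [T], [f (k S) / q ^ k = 1 + O(E / eta)]. The
    conditional probability of meeting [G] in a window is [1 - q + O(E)], and
    [1 - q] is at least [eta / 8] because, by supermultiplicativity, a tail
    closer to [1] would make [T] too large ([tail_bounded_above]). Its relative
    error is thus [O(E / eta)] as well, which gives the claim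
    ([nearly_geometric_increments]). The statement on powers [gamma] follows,
    as [max eps r / (max eps r) ^ gamma = (max eps r) ^ (1 - gamma)] is small
    with [max eps r]. *)

Set Implicit Arguments.
Unset Strict Implicit.
Unset Printing Implicit Defensive.

Import Order.TTheory GRing.Theory Num.Theory.

Local Open Scope classical_set_scope.
Local Open Scope ring_scope.

(** * Summing a sequence with a multiplicative recursion *)

Section SumFromRecursion.
Variables (R : realType) (f : nat -> R).

(** That [T] is the sum of the series of the nonnegative [f n], as the least
    upper bound of the partial sums, so that inequalities on [T] reduce to
    inequalities on finite sums. *)
Definition total_mass (T : R) : Prop :=
  (forall j, \sum_(n < j) f n <= T) /\
  (forall B, (forall j, \sum_(n < j) f n <= B) -> T <= B).

Lemma sum_shift m j :
  \sum_(n < m + j) f n = \sum_(n < m) f n + \sum_(n < j) f (m + n)%N.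
Proof. by rewrite big_split_ord. Qed.

Hypothesis f_ge0 : forall n, 0 <= f n.
Hypothesis f_le1 : forall n, f n <= 1.

(** The first [m] terms are at most [1] each, and the shifted remainder is
    dominated by [q] times the sum itself. The bound is on partial sums because
    it also serves to prove that the series converges. *)
Lemma partial_sum_le_of_decay m (q : R) : 0 <= q ->
  (forall n, f (n + m)%N <= q * f n) ->
  forall j, \sum_(n < j) f n <= m%:R + q * \sum_(n < j) f n.
Proof.
move=> q0 dec j.
have le_more : \sum_(n < j) f n <= \sum_(n < m + j) f n.
  by rewrite addnC sum_shift lerDl sumr_ge0.
apply: (le_trans le_more); rewrite sum_shift; apply: lerD.
  rewrite -[m in m%:R]card_ord -sum1_card natr_sum.
  by apply: ler_sum => i _; exact: f_le1.
by rewrite mulr_sumr; apply: ler_sum => i _; rewrite addnC dec.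
Qed.

Lemma total_mass_le_of_decay T m (q : R) : total_mass T -> 0 <= q ->
  (forall n, f (n + m)%N <= q * f n) -> T <= m%:R + q * T.
Proof.
move=> [ubT lubT] q0 dec; apply: lubT => j.
apply: (le_trans (partial_sum_le_of_decay q0 dec j)).
by rewrite lerD2l ler_wpM2l.
Qed.

Lemma total_mass_ge_of_growth T s (g : R) : total_mass T -> 0 < g ->
  {homo f : m n / (m <= n)%N >-> n <= m} ->
  (forall n, g * f n <= f (n + s)%N) -> s%:R * f s + g * T <= T.
Proof.
move=> [ubT lubT] g0 fmono gr.
suff: T <= (T - s%:R * f s) / g by rewrite ler_pdivlMr // mulrC lerBrDl.
apply: lubT => j; rewrite ler_pdivlMr // mulrC lerBrDl.
apply: le_trans (ubT (s + j)%N); rewrite sum_shift; apply: lerD.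
  rewrite mulr_natl -[s in _ *+ s]card_ord -sumr_const.
  by apply: ler_sum => i _; apply: fmono; exact: ltnW.
by rewrite mulr_sumr; apply: ler_sum => i _; rewrite (addnC s) gr.
Qed.

End SumFromRecursion.

Lemma halves_le s :
  [/\ (s./2 <= s)%N, (2 * s./2 <= s.+1)%N & (2 * (s - s./2) <= s.+1)%N].
Proof. by split; lia. Qed.

(** * Approximate memorylessness of a tail satisfying the restarting bounds *)

Section RenewalBounds.
Variables (R : realType) (f : nat -> R) (N : nat) (r e T : R).
Let E := e + r.

Hypothesis f0 : f 0%N = 1.
Hypothesis f_ge0 : forall n, 0 <= f n.
Hypothesis f_mono : {homo f : m n / (m <= n)%N >-> n <= m}.
Hypothesis f_le_renew : forall t s, (N <= s)%N ->
  f (t + s)%N <= f t * (r + f (s - N)%N).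
Hypothesis f_ge_renew : forall t s,
  (f (t + N)%N - r * f t) * f s <= f (t + s)%N.
Hypothesis T_total : total_mass f T.
Hypothesis N_gt0 : (0 < N)%N.
Hypothesis T_gt0 : 0 < T.
Hypothesis N_le : N%:R <= e * T.
Hypothesis r_ge0 : 0 <= r.
Hypothesis E_small : E <= 1 / 1000.

Let f_le1 n : f n <= 1. Proof. by rewrite -f0; exact: f_mono. Qed.

Let e_ge0 : 0 <= e.
Proof. by rewrite -(pmulr_lge0 _ T_gt0); apply: le_trans N_le. Qed.

Lemma one_le_eT : 1 <= e * T.
Proof. by apply: le_trans N_le; rewrite (ler_nat _ 1). Qed.

(** By [f_le_renew], [f] shrinks by [r + f s] every [s + N] steps, so its sum
    [T] is at most [(s + N) / (1 - r - f s)]. *)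
Lemma tail_ge_linear s : 1 - E - s%:R / T <= f s.
Proof.
have := @total_mass_le_of_decay _ f f_ge0 f_le1 T (s + N) (r + f s) T_total.
move=> /(_ (addr_ge0 r_ge0 (f_ge0 s))) H.
have {}H : T <= (s + N)%:R + (r + f s) * T.
  by apply: H => n; rewrite mulrC -{2}(addnK N s) f_le_renew// leq_addl.
rewrite -(ler_pM2r T_gt0) !mulrBl mulfVK ?gt_eqF // mul1r /E.
by rewrite natrD in H; move: N_le; nra.
Qed.

Lemma tail_2N_ge : 1 - 3 * E <= f (2 * N)%N.
Proof.
apply: le_trans (tail_ge_linear _).
have : (2 * N)%:R / T <= 2 * e.
  by rewrite ler_pdivrMr// natrM; move: N_le; lra.
by rewrite /E; move: r_ge0; lra.
Qed.

(** Suppose the chain survives until [t]. Looking back at time [t - N], it has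
    restarted from [x0] during the [N] steps before [t], up to an error [r], and
    from there [2 N] steps lead to [G] with probability at most [3 E]. This
    bounds the loss between [t] and [t + N] by [4 E] times [f (t - N)], and the
    induction hypothesis at [t - N] makes [f (t - N)] at most [2 * f t], whence
    the constant [8]. *)
Lemma hazard_N_small t : (1 - 8 * E) * f t <= f (t + N)%N.
Proof.
have E0 : 0 <= E by rewrite /E addr_ge0.
have f2 := tail_2N_ge; rewrite mul2n -addnn in f2.
elim/ltn_ind: t => t IH.
case: (ltnP t N) => [tN|Nt].
  have : f (N + N)%N <= f (t + N)%N by apply: f_mono; rewrite leq_add2r ltnW.
  have : 0 <= (1 - 8 * E) * (1 - f t).
    by apply: mulr_ge0; [move: E_small; lra | rewrite subr_ge0 f_le1].
  by move: f2 E0; lra.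
set t' := (t - N)%N; have tK : (t' + N)%N = t by rewrite subnK.
have ft : (1 - 8 * E) * f t' <= f t.
  by rewrite -[in leRHS]tK; apply: IH; rewrite -tK -[ltnLHS]addn0 ltn_add2l.
have := f_ge_renew t' (2 * N); rewrite mul2n -addnn addnA tK => B.
have := f_ge0 t'; have := f_ge0 t => ft0 ft'0.
have le_tt' : f t <= f t' by apply: f_mono; exact: leq_subr.
have rE : r <= E by rewrite /E lerDr.
have half : 0 <= 2 * f t - f t' by move: E_small; nra.
have x_le : f t - r * f t' <= f t' by move: r_ge0; nra.
have step : f t - r * f t' - 3 * E * f t' <= f (t + N)%N.
  apply: le_trans B.
  have : 0 <= (f t' - (f t - r * f t')) * (1 - f (N + N)%N).
    by apply: mulr_ge0; rewrite subr_ge0 // f_le1.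
  by nra.
have := mulr_ge0 E0 half.
have : 0 <= (E - r) * f t' by rewrite mulr_ge0 // subr_ge0.
by move: step; lra.
Qed.

Lemma tail_supermult t s : (1 - 9 * E) * f t * f s <= f (t + s)%N.
Proof.
apply: le_trans (f_ge_renew t s); apply: ler_wpM2r => //.
by have := hazard_N_small t; have := mulr_ge0 e_ge0 (f_ge0 t); rewrite /E; lra.
Qed.

Lemma tail_submult t s : (N <= s)%N -> f (t + s)%N <= f t * (f s + 9 * E).
Proof.
move=> Ns; apply: (le_trans (f_le_renew t Ns)); apply: ler_wpM2l => //.
have := hazard_N_small (s - N); rewrite subnK //.
have : r <= E by rewrite /E lerDr.
have : 0 <= E * (1 - f (s - N)%N).
  by rewrite mulr_ge0 // ?subr_ge0 // /E addr_ge0.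
by lra.
Qed.

(** At scale [T] itself [tail_ge_linear] is void; it gives [1 / 3] at scale
    [T / 2], and supermultiplicativity doubles the scale. *)
Lemma tail_bounded_below s : s%:R <= T -> 1 / 16 <= f s.
Proof.
move=> sT.
have E0 : 0 <= E by rewrite /E addr_ge0.
have eE : e <= E by rewrite /E lerDl.
have half m : 2 * m%:R <= s%:R + 1 :> R -> 1 / 3 <= f m.
  move=> hm; apply: le_trans (tail_ge_linear m).
  have : m%:R / T <= 1 / 2 + E.
    have : 0 <= (E - e) * T by rewrite mulr_ge0 ?subr_ge0 // ltW.
    by rewrite ler_pdivrMr //; have := one_le_eT; move: sT hm; lra.
  by move: E_small; lra.
have [ss' s1' s2'] := halves_le s.
have s1 : 1 / 3 <= f s./2.
  by apply: half; rewrite -natrM natr1 ler_nat.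
have s2 : 1 / 3 <= f (s - s./2)%N.
  by apply: half; rewrite -natrM natr1 ler_nat.
have := tail_supermult s./2 (s - s./2); rewrite subnKC //.
apply: le_trans.
have : 0 <= (f s./2 - 1 / 3) * (f (s - s./2)%N - 1 / 3).
  by rewrite mulr_ge0 ?subr_ge0.
have : 0 <= (1 / 64 - E) * (f s./2 * f (s - s./2)%N).
  by rewrite mulr_ge0 ?mulr_ge0 // subr_ge0; move: E_small; lra.
by move: s1 s2; lra.
Qed.

(** The mass [T] also limits [f] from above: as [f] keeps at least a factor [g]
    over [s] steps, [s * g + g * T <= T]. *)
Lemma tail_bounded_above s : s%:R <= T -> s%:R / (2 * T) - 9 * E <= 1 - f s.
Proof.
move=> sT; set g := (1 - 9 * E) * f s.
have E0 : 0 <= E by rewrite /E addr_ge0.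
have fs := tail_bounded_below sT.
have g0 : 0 < g by rewrite mulr_gt0; move: E_small fs; lra.
have g_ge : f s - 9 * E <= g.
  have : 0 <= E * (1 - f s) by rewrite mulr_ge0 // subr_ge0.
  by rewrite /g; lra.
have g_le : g <= f s.
  by have := mulr_ge0 E0 (f_ge0 s); rewrite /g; lra.
have growth n : g * f n <= f (n + s)%N.
  by rewrite /g mulrAC; exact: tail_supermult.
have gT := total_mass_ge_of_growth T_total g0 f_mono growth.
have sg : s%:R * g <= s%:R * f s by rewrite ler_wpM2l.
(* This turns [s / (T + s)] into the simpler lower bound [s / (2 * T)]. *)
have Tsg : 0 <= (T - s%:R) * (1 - g).
  by rewrite mulr_ge0 // subr_ge0 // (le_trans g_le).
suff : s%:R / (2 * T) <= 1 - g by move: g_ge; lra.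
by rewrite ler_pdivrMr ?mulr_gt0 //; move: gT sg Tsg; lra.
Qed.

End RenewalBounds.

(** * Increments of a nearly geometric sequence *)

Section NearlyGeometric.
Variables (R : realType) (a : nat -> R) (q x : R).
Hypothesis a0 : a 0%N = 1.
Hypothesis a_ge0 : forall k, 0 <= a k.
Hypothesis q_gt0 : 0 < q.
Hypothesis x_ge0 : 0 <= x.

(** The errors of [k] steps add up by the Bernoulli inequality. *)
Lemma geometric_lower k : x <= 1 ->
  (forall j, (1 - x) * q * a j <= a j.+1) -> (1 - k%:R * x) * q ^+ k <= a k.
Proof.
move=> x_le1 low; elim: k => [|k IH].
  by rewrite a0 expr0 mul0r subr0 mul1r.
apply: le_trans (low k); apply: le_trans; last first.
  by apply: ler_wpM2l IH; rewrite mulr_ge0 ?subr_ge0 // ltW.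
rewrite exprS [leRHS](_ : _ = ((1 - x) * (1 - k%:R * x)) * (q * q ^+ k));
  last by ring.
apply: ler_wpM2r; first by rewrite mulr_ge0 ?exprn_ge0 // ltW.
have : 0 <= k%:R * x * x by rewrite !mulr_ge0.
by rewrite -natr1; lra.
Qed.

(** [(1 + x) ^ k] is bounded by the inverse of [1 - k * x]; keeping that factor
    on the left makes the induction step [(1 + x) * (1 - (k + 1) * x) <=
    1 - k * x]. *)
Lemma geometric_upper k : k%:R * x <= 1 ->
  (forall j, a j.+1 <= (1 + x) * q * a j) -> a k * (1 - k%:R * x) <= q ^+ k.
Proof.
move=> + up; elim: k => [|k IH] kx.
  by rewrite a0 expr0 mul0r subr0 mul1r.
have kx' : k%:R * x <= 1 by apply: le_trans kx; rewrite ler_wpM2r // ler_nat.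
apply: (@le_trans _ _ ((1 + x) * q * a k * (1 - k.+1%:R * x))).
  by apply: ler_wpM2r => //; rewrite subr_ge0.
rewrite exprS; apply: (@le_trans _ _ (q * (a k * (1 - k%:R * x)))); last first.
  by apply: ler_wpM2l; [exact: ltW | exact: IH].
rewrite [leLHS](_ : _ = q * (a k * ((1 + x) * (1 - k.+1%:R * x))));
  last by ring.
apply: ler_wpM2l; first exact: ltW.
apply: ler_wpM2l => //.
have : 0 <= k%:R * x * x by rewrite !mulr_ge0.
have : 0 <= x * x by rewrite mulr_ge0.
by rewrite -natr1; lra.
Qed.

End NearlyGeometric.

Lemma le_of_mul_one_minus_le1 (R : realType) (A u : R) :
  0 <= A -> 0 <= u -> u <= 1 / 1000 -> A * (1 - 144 * u) <= 1 ->
  A <= 1 + 288 * u.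
Proof.
move=> A0 u0 u_small A_up.
have Au : A * u <= A * (1 / 1000) by exact: ler_wpM2l.
have A2 : A <= 2 by move: Au A_up A0; clear; lra.
have A2u : 0 <= (2 - A) * u by rewrite mulr_ge0 ?subr_ge0.
by move: A_up A2u; clear; lra.
Qed.

(** With [A = ak / Q], the ratio [D] equals [A * (1 - ak1 / ak) / (1 - q)]. The
    first factor is [1 + O(u)]; in the second, the error of order [E] on the
    numerator is compared with [1 - q], which is at least [E / (8 * u)]. *)
Lemma relative_increment_bound (R : realType) (ak ak1 Q q E u : R) :
  0 < Q -> q < 1 -> 0 <= ak -> 0 <= E -> 0 < u -> u <= 1 / 1000 ->
  E <= 8 * u * (1 - q) ->
  ak1 <= ak * (q + 9 * E) -> (1 - 17 * E) * q * ak <= ak1 ->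
  (1 - 144 * u) * Q <= ak -> ak * (1 - 144 * u) <= Q ->
  `| (ak - ak1) / (Q * (1 - q)) - 1 | < 1000 * u.
Proof.
move=> Q0 q_lt1 ak0 E0 u0 u_small Eu up low lower upper.
have {}low : ak * (q - 17 * E) <= ak1.
  apply: le_trans low; have : 0 <= (1 - q) * (E * ak).
    by rewrite !mulr_ge0 // subr_ge0 ltW.
  by clear; lra.
set A := ak / Q; have aA : ak = A * Q by rewrite /A mulfVK // gt_eqF.
have A_ge0 : 0 <= A by rewrite /A divr_ge0 // ltW.
have A_low : 1 - 144 * u <= A by rewrite /A ler_pdivlMr.
have A_up : A <= 1 + 288 * u.
  apply: le_of_mul_one_minus_le1 => //; first exact: ltW.
  by rewrite /A mulrAC ler_pdivrMr // mul1r.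
have q1' : 0 < 1 - q by rewrite subr_gt0.
have Q1 : 0 < Q * (1 - q) by rewrite mulr_gt0.
set D := (ak - ak1) / (Q * (1 - q)).
have DE : D * (Q * (1 - q)) = ak - ak1 by rewrite /D mulfVK // gt_eqF.
have AE : 0 <= A * Q * (8 * u * (1 - q) - E).
  by apply: mulr_ge0; [apply: mulr_ge0 => //; exact: ltW | rewrite subr_ge0].
have D_low : A - 72 * u * A <= D.
  rewrite -(ler_pM2r Q1) DE; rewrite aA in up *.
  by move: up AE; clear; lra.
have D_up : D <= A + 136 * u * A.
  rewrite -(ler_pM2r Q1) DE; rewrite aA in low *.
  by move: low AE; clear; lra.
have Au : 0 <= u * (2 - A).
  by rewrite mulr_ge0 ?(ltW u0) // subr_ge0; move: A_up u_small; clear; lra.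
by rewrite ltr_norml; apply/andP; split;
  move: D_low D_up A_low A_up Au u0; clear; lra.
Qed.

(** The step errors are additive from above and multiplicative from below, the
    forms produced by restarting. The lower bound [1 / 16] on [q] makes the
    former multiplicative too, with [9 * 16 = 144]; the lower bound on [1 - q]
    controls the relative error of one increment; and [k <= 1 / eta] steps
    accumulate an error [O(E / eta)]. *)
Lemma nearly_geometric_increments (R : realType) (a : nat -> R)
    (q E eta : R) (k : nat) :
  a 0%N = 1 -> (forall j, 0 <= a j) -> 1 / 16 <= q -> q <= 1 ->
  eta / 8 <= 1 - q -> 0 < eta -> eta <= 1 -> 0 < E -> E <= eta / 1000 ->
  (forall j, a j.+1 <= a j * (q + 9 * E)) ->
  (forall j, (1 - 17 * E) * q * a j <= a j.+1) ->
  k%:R * eta <= 1 ->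
  `| (a k - a k.+1) / (q ^+ k * (1 - q)) - 1 | < 1000 * (E / eta).
Proof.
move=> a0 a_ge0 q16 q1 qeta eta0 eta1 E0 Eeta up low keta.
have q0 : 0 < q by move: q16; clear; lra.
have q_lt1 : q < 1 by move: qeta eta0; clear; lra.
set u := E / eta; have Eu : E = u * eta by rewrite /u mulfVK // gt_eqF.
have u0 : 0 < u by rewrite divr_gt0.
have u_small : u <= 1 / 1000.
  by rewrite /u ler_pdivrMr // mulrAC mul1r.
set x := 144 * E; have x0 : 0 <= x.
  by apply: mulr_ge0; [exact: ler0n | exact: ltW].
have x1 : x <= 1 by rewrite /x; move: Eeta eta1; clear; lra.
have kx : k%:R * x <= 144 * u.
  have := ler_wpM2r (ltW u0) keta; rewrite /x Eu.
  by move: (k%:R) => c; clear; lra.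
have kx1 : k%:R * x <= 1 by move: kx u_small; clear; lra.
have low' j : (1 - x) * q * a j <= a j.+1.
  apply: le_trans (low j); rewrite -!mulrA; apply: ler_wpM2r.
    by rewrite mulr_ge0 // ltW.
  by rewrite /x; move: E0; clear; lra.
have up' j : a j.+1 <= (1 + x) * q * a j.
  apply: (le_trans (up j)); rewrite mulrC; apply: ler_wpM2r => //.
  by have := ler_wpM2r (ltW E0) q16; rewrite /x; clear; lra.
have lower := geometric_lower a0 q0 x0 k x1 low'.
have upper := geometric_upper a0 a_ge0 q0 x0 kx1 up'.
have qk0 : 0 < q ^+ k by rewrite exprn_gt0.
apply: (@relative_increment_bound _ _ _ _ _ E) => //; first exact: ltW.
- by have := ler_wpM2l (ltW u0) qeta; rewrite Eu; clear; lra.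
- by apply: le_trans lower; rewrite ler_wpM2r ?(ltW qk0) // lerD2l lerN2.
- by apply: le_trans upper; rewrite ler_wpM2l // lerD2l lerN2.
Qed.

(** The integer parts of the multiples of [S] are spaced by [truncn S] or one
    more; the extra step is absorbed by [hazard_N_small]. *)
Lemma truncn_scale_step (R : realType) (S : R) k : 0 <= S ->
  (Num.truncn (k%:R * S) + Num.truncn S <= Num.truncn (k.+1%:R * S)
    <= (Num.truncn (k%:R * S) + Num.truncn S).+1)%N.
Proof.
move=> S0.
have kS m : 0 <= m%:R * S by rewrite mulr_ge0.
have /andP[l1 u1] := truncn_itv S0; have /andP[l2 u2] := truncn_itv (kS k).
have kS1 : k.+1%:R * S = k%:R * S + S by rewrite -natr1 mulrDl mul1r.
apply/andP; split.
  by rewrite truncn_ge_nat // natrD kS1 lerD.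
rewrite -ltnS truncn_lt_nat // kS1.
rewrite -addnS -addSn natrD; exact: ltrD.
Qed.

Lemma early_tail_increments (R : realType) (f : nat -> R) (N k : nat)
    (r e T eta : R) (E := e + r) (s := Num.truncn (eta * T)) :
  f 0%N = 1 -> (forall n, 0 <= f n) ->
  {homo f : m n / (m <= n)%N >-> n <= m} ->
  (forall t s, (N <= s)%N -> f (t + s)%N <= f t * (r + f (s - N)%N)) ->
  (forall t s, (f (t + N)%N - r * f t) * f s <= f (t + s)%N) ->
  total_mass f T -> (0 < N)%N -> 0 < T -> N%:R <= e * T -> 0 < r ->
  0 < eta -> eta <= 1 -> E <= eta / 1000 -> k%:R * eta <= 1 ->
  [/\ f s != 0, 1 - f s != 0 &
  `| (f (Num.truncn (k%:R * (eta * T))) - f (Num.truncn (k.+1%:R * (eta * T))))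
      / (f s ^+ k * (1 - f s)) - 1 | < 1000 * (E / eta)].
Proof.
move=> f0 f_ge0 f_mono f_le_renew f_ge_renew T_total N_gt0 T_gt0 N_le r_gt0.
move=> eta_gt0 eta_le1 E_small keta.
have r_ge0 := ltW r_gt0.
have e_ge0 : 0 <= e.
  by rewrite -(pmulr_lge0 _ T_gt0); apply: le_trans N_le.
have E_gt0 : 0 < E by rewrite ltr_wpDl.
have E1000 : E <= 1 / 1000 by move: E_small eta_le1; clear; lra.
have eT1 : 1 <= e * T by apply: le_trans N_le; rewrite (ler_nat _ 1).
have S_ge0 : 0 <= eta * T by rewrite mulr_ge0 // ltW.
have eE : e <= eta / 1000 by move: E_small r_ge0; rewrite /E; clear; lra.
have eTS : e * T <= eta * T / 1000.
  by have := ler_wpM2r (ltW T_gt0) eE; clear; lra.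
have /andP[s_le s_gt] := truncn_itv S_ge0; rewrite -/s in s_le s_gt.
have Ns : (N <= s)%N.
  by rewrite truncn_ge_nat //; move: N_le eTS S_ge0; clear; lra.
have sT : s%:R <= T.
  apply: (le_trans s_le); rewrite -[leRHS]mul1r; apply: ler_wpM2r => //.
  exact: ltW.
have s_half : eta * T / 2 <= s%:R.
  have s1 : (1 : R) <= s%:R by rewrite (ler_nat _ 1); exact: leq_trans Ns.
  by move: s_gt s1; rewrite -natr1; move: (s%:R) => c; clear; lra.
have s16 : 1 / 16 <= f s by apply: (@tail_bounded_below _ f N r e T).
have f_le1 n : f n <= 1 by rewrite -f0 f_mono.
have s_eta : eta / 8 <= 1 - f s.
  have := @tail_bounded_above _ f N r e T f0 f_ge0 f_mono f_le_renew
    f_ge_renew T_total N_gt0 T_gt0 N_le r_ge0 E1000 s sT.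
  have : eta / 4 <= s%:R / (2 * T).
    rewrite ler_pdivlMr ?mulr_gt0 //; move: s_half.
    by move: (s%:R) => c; clear; lra.
  by rewrite -/E; move: (s%:R / _) E_small eta_gt0 => c; clear; lra.
have fs0 : 0 < f s by move: s16; clear; lra.
have fs1 : 0 < 1 - f s by move: s_eta eta_gt0; clear; lra.
split; [by rewrite gt_eqF | by rewrite gt_eqF |].
pose a j := f (Num.truncn (j%:R * (eta * T))).
apply: (@nearly_geometric_increments _ a) => //.
- by rewrite /a mul0r truncn0.
- by move=> j; apply: f_ge0.
- move=> j; have /andP[lo _] := truncn_scale_step j S_ge0.
  apply: (le_trans (f_mono _ _ lo)).
  exact: (@tail_submult _ f N r e T).
- move=> j; have /andP[_ hi] := truncn_scale_step j S_ge0.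
  apply: le_trans (f_mono _ _ hi); rewrite -/s.
  set t := Num.truncn (j%:R * _).
  apply: (@le_trans _ _ (f (t + s + N)%N)); last first.
    by apply: f_mono; rewrite -addn1 leq_add2l.
  apply: le_trans; last by apply: (@hazard_N_small _ f N r e T).
  have : (1 - 9 * (e + r)) * f t * f s <= f (t + s)%N.
    exact: (@tail_supermult _ f N r e T).
  rewrite -/E /a -/t => super.
  have E8 : 0 <= 1 - 8 * E by move: E1000; clear; lra.
  apply: le_trans (ler_wpM2l E8 super).
  have : 0 <= E * E * (f t * f s) by rewrite !mulr_ge0 // ltW.
  by clear; lra.
Qed.

(** * Survival probabilities of a finite chain and restarting at x0 *)

Section Survival.
Variables (R : realType) (St : finType) (p : St -> St -> R).
Hypothesis p_stoch : stochastic p.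

(** One step of the chain killed in [F]: a positive linear operator whose
    iterates express the Markov property at a fixed time. *)
Definition killed (F : set St) (h : St -> R) (x : St) : R :=
  (x \notin F)%:R * \sum_y p x y * h y.

(** The probability that the chain started at the argument avoids [F] at all
    times [0, ..., n]; see [prob_avoids]. *)
Definition survival (F : set St) (n : nat) : St -> R :=
  iter n (killed F) (fun x => (x \notin F)%:R).

Implicit Types (F G : set St) (h : St -> R) (x y : St) (m n s t : nat).

Lemma stochastic_mean_cst (c : R) x : \sum_y p x y * c = c.
Proof. by rewrite -mulr_suml p_stoch.2 mul1r. Qed.

Lemma ler_stochastic_mean x h1 h2 : (forall y, h1 y <= h2 y) ->
  \sum_y p x y * h1 y <= \sum_y p x y * h2 y.
Proof. by move=> le12; apply: ler_sum => y _; rewrite ler_wpM2l ?p_stoch.1. Qed.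

Lemma killed_mono F h1 h2 x : (forall y, h1 y <= h2 y) ->
  killed F h1 x <= killed F h2 x.
Proof. by move=> le12; rewrite ler_wpM2l // ler_stochastic_mean. Qed.

Lemma iter_killed_mono F n h1 h2 x : (forall y, h1 y <= h2 y) ->
  iter n (killed F) h1 x <= iter n (killed F) h2 x.
Proof. by move=> le12; elim: n x => //= n IH x; exact: killed_mono. Qed.

Lemma iter_killed_linear F n (a b : R) h1 h2 x :
  iter n (killed F) (fun y => a * h1 y + b * h2 y) x =
  a * iter n (killed F) h1 x + b * iter n (killed F) h2 x.
Proof.
elim: n x => //= n IH x; rewrite /killed.
under eq_bigr do rewrite IH mulrDr !(mulrCA (p _ _)).
by rewrite big_split /= -!mulr_sumr mulrDr !(mulrCA (_ \notin _)%:R).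
Qed.

Lemma survival_add F t s x :
  survival F (t + s) x = iter t (killed F) (survival F s) x.
Proof. by rewrite /survival iterD. Qed.

Lemma survival_in F n x : x \in F -> survival F n x = 0.
Proof. by case: n => [|n] xF; rewrite /survival /= /killed xF ?mul0r. Qed.

Lemma survivalS_notin F n x : x \notin F ->
  survival F n.+1 x = \sum_y p x y * survival F n y.
Proof. by move=> xF; rewrite /survival /= /killed xF mul1r. Qed.

Lemma survival_ge0 F n x : 0 <= survival F n x.
Proof.
elim: n x => [|n IH] x; first exact: ler0n.
by rewrite mulr_ge0 // sumr_ge0 // => y _; rewrite mulr_ge0 ?p_stoch.1.
Qed.

Lemma survival_le1 F n x : survival F n x <= 1.
Proof.
elim: n x => [|n IH] x; first by rewrite lern1 leq_b1.
apply: mulr_ile1 => //; rewrite ?lern1 ?leq_b1 //.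
  by rewrite sumr_ge0 // => y _; rewrite mulr_ge0 ?p_stoch.1 ?survival_ge0.
by rewrite -[leRHS](stochastic_mean_cst 1 x) ler_stochastic_mean.
Qed.

Lemma survivalS_le F n x : survival F n.+1 x <= survival F n x.
Proof.
rewrite -addn1 survival_add; apply: iter_killed_mono => y.
have [yF|yF] := boolP (y \in F); first by rewrite survival_in // ler0n.
exact: survival_le1.
Qed.

Lemma survival_mono F x :
  {homo (survival F)^~ x : m n / (m <= n)%N >-> n <= m}.
Proof.
apply: homo_leq => [//|b a c ba cb|n]; first exact: le_trans cb ba.
exact: survivalS_le.
Qed.

Section Renewal.
Variables (G : set St) (x0 : St).
Let f n := survival G n x0.
Let v n := survival (x0 |` G) n.

Let in_target y : (y \in x0 |` G) = (y == x0) || (y \in G).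
Proof.
apply/idP/idP => [|/orP[/eqP ->|]]; rewrite !inE; last by right.
  by case=> [->|Gy]; apply/orP; [left | right; rewrite inE].
by left.
Qed.

(** Either [x0 |` G] is avoided for [N] steps, or [x0] is met within [N] steps
    and at least [s - N] steps remain to be survived from there. *)
Lemma survival_le_renew N s x : (N <= s)%N ->
  survival G s x <= v N x + f (s - N)%N.
Proof.
elim: N s x => [|N IH] s x Ns.
  rewrite subn0; have [|xF] := boolP (x \in x0 |` G); last first.
    rewrite [v 0%N x](_ : _ = 1); last by rewrite /v /survival /= xF.
    by apply: ler_wpDr; [exact: survival_ge0 | exact: survival_le1].
  rewrite in_target => /orP[/eqP ->|xG].
    by rewrite lerDr; exact: survival_ge0.
  by rewrite survival_in // addr_ge0 //; exact: survival_ge0.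
have [|xF] := boolP (x \in x0 |` G).
  rewrite in_target => /orP[/eqP ->|xG].
    apply: ler_wpDl; first exact: survival_ge0.
    by apply: survival_mono; exact: leq_subr.
  by rewrite survival_in // addr_ge0 //; exact: survival_ge0.
have xG : x \notin G by move: xF; rewrite in_target negb_or => /andP[].
case: s Ns => // s Ns; rewrite survivalS_notin // /v survivalS_notin // subSS.
rewrite -[f _](stochastic_mean_cst _ x) -big_split /=.
by apply: ler_sum => y _; rewrite -mulrDr ler_wpM2l ?p_stoch.1 // IH.
Qed.

(** [survival G N x - v N x] is the probability of avoiding [G] for [N] steps
    while meeting [x0]. Surviving [s] steps after that meeting is more than
    surviving until [s]. *)
Lemma survival_ge_renew N s x :
  (survival G N x - v N x) * f s <= survival G s x.
Proof.
elim: N x => [|N IH] x.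
  have [xF|xF] := boolP (x \in x0 |` G); last first.
    have xG : x \notin G by move: xF; rewrite in_target negb_or => /andP[].
    by rewrite /v /survival /= xF xG subrr mul0r survival_ge0.
  rewrite [v _ _]survival_in // subr0.
  move: xF; rewrite in_target => /orP[/eqP ->|xG].
    by rewrite ler_piMl ?survival_ge0 ?survival_le1.
  by rewrite survival_in // mul0r survival_ge0.
have [xF|xF] := boolP (x \in x0 |` G).
  rewrite [v _ _]survival_in // subr0.
  move: xF; rewrite in_target => /orP[/eqP ->|xG].
    by rewrite ler_piMl ?survival_ge0 ?survival_le1.
  by rewrite survival_in // mul0r survival_ge0.
have xG : x \notin G by move: xF; rewrite in_target negb_or => /andP[].
apply: le_trans (survivalS_le _ _ _).
rewrite /v !survivalS_notin // -sumrB mulr_suml.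
apply: ler_sum => y _; by rewrite -mulrBr -mulrA ler_wpM2l ?p_stoch.1.
Qed.

Variables (N : nat) (r : R).
Hypothesis rec : forall x, v N x <= r.

(** Apply [survival_le_renew] to the state at time [t]: the bound is constant
    off [G], and [iter t (killed G)] preserves pointwise inequalities. *)
Lemma tail_le_renew t s : (N <= s)%N -> f (t + s)%N <= f t * (r + f (s - N)%N).
Proof.
move=> Ns; rewrite /f survival_add.
rewrite (_ : _ * _ = iter t (killed G) (fun y =>
  (r + f (s - N)%N) * survival G 0 y + 0 * survival G 0 y) x0); last first.
  by rewrite iter_killed_linear mul0r addr0 mulrC -survival_add addn0.
apply: iter_killed_mono => y; rewrite mul0r addr0.
have [yG|yG] := boolP (y \in G).
  by rewrite !survival_in // mulr0.
rewrite {2}/survival /= yG mulr1.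
by apply: le_trans (survival_le_renew _ Ns) _; rewrite lerD2r.
Qed.

Lemma tail_ge_renew t s : (f (t + N)%N - r * f t) * f s <= f (t + s)%N.
Proof.
rewrite /f !survival_add.
rewrite (_ : _ * _ = iter t (killed G) (fun y =>
  f s * survival G N y + (- (f s * r)) * survival G 0 y) x0); last first.
  by rewrite iter_killed_linear -!survival_add addn0 /f; ring.
apply: iter_killed_mono => y.
have [yG|yG] := boolP (y \in G).
  by rewrite !survival_in // !mulr0 addr0.
rewrite {2}/survival /= yG mulr1.
apply: le_trans (survival_ge_renew N s y).
rewrite -mulrBr mulrC ler_wpM2r ?survival_ge0 //.
by rewrite lerD2l lerN2.
Qed.

End Renewal.

Lemma nstep_le1 n x y : nstep p n x y <= 1.
Proof.
elim: n x => [|n IH] x /=; first by rewrite lern1 leq_b1.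
by rewrite -[leRHS](stochastic_mean_cst 1 x) ler_stochastic_mean.
Qed.

(** Avoiding [G] up to time [n] excludes being at [g] at time [n]. *)
Lemma survival_nstep_le1 G n x g : g \in G ->
  survival G n x + nstep p n x g <= 1.
Proof.
move=> gG; elim: n x => [|n IH] x.
  rewrite /survival /=; case: eqP => [->|_]; first by rewrite gG add0r.
  by rewrite addr0 lern1 leq_b1.
have [xG|xG] := boolP (x \in G).
  by rewrite survival_in // add0r nstep_le1.
rewrite survivalS_notin // -big_split /= -[leRHS](stochastic_mean_cst 1 x).
by apply: ler_sum => y _; rewrite -mulrDr ler_wpM2l ?p_stoch.1.
Qed.

(** By irreducibility each state reaches [G] with positive probability within
    some number of steps; finiteness of the state space makes both uniform.
    This is what makes the mean hitting time finite. *)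
Lemma uniform_absorption G : irreducible p -> G !=set0 ->
  exists m q, [/\ 0 <= q, q < 1 & forall x, survival G m x <= q].
Proof.
move=> irr [g Gg]; have gG : g \in G by rewrite inE.
have /choice[n n_gt0] : forall x, exists n, 0 < nstep p n x g by [].
pose m := (\max_x n x)%N.
exists m, (\big[Num.max/0]_x survival G m x); split.
- by rewrite bigmax_ge_id.
- apply/bigmax_ltP; split=> // x _.
  apply: (@le_lt_trans _ _ (survival G (n x) x)).
    by apply: survival_mono; rewrite /m leq_bigmax.
  apply: lt_le_trans (survival_nstep_le1 (n x) x gG).
  by rewrite ltrDl.
- by move=> x; rewrite le_bigmax.
Qed.

Lemma survival_geometric G m (q : R) : (forall x, survival G m x <= q) ->
  forall n x, survival G (n + m) x <= q * survival G n x.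
Proof.
move=> le_q n x; rewrite survival_add.
rewrite (_ : _ * _ = iter n (killed G) (fun y =>
  q * survival G 0 y + 0 * survival G 0 y) x); last first.
  by rewrite iter_killed_linear mul0r addr0 -survival_add addn0.
apply: iter_killed_mono => y; rewrite mul0r addr0.
have [yG|yG] := boolP (y \in G); first by rewrite !survival_in // mulr0.
by rewrite {2}/survival /= yG mulr1.
Qed.

End Survival.

(** * Law of the hitting time of a Markov chain *)

Section HittingTime.
Variables (R : realType) (Omega : Type) (St : finType).
Variables (Z : nat -> Omega -> St) (F : set St).

Definition avoids (m n : nat) : set Omega :=
  [set w | forall i, (m <= i <= n)%N -> ~ F (Z i w)].

Lemma hitting_time_least w m : F (Z m w) ->
  (forall i, (i < m)%N -> ~ F (Z i w)) -> hitting_time R Z F w = m%:R%:E.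
Proof.
move=> Fm before; apply/eqP; rewrite eq_le; apply/andP; split.
  by apply: ereal_inf_lbound; exists m.
apply: le_ereal_inf_tmp => _ [i /= Fi <-]; rewrite lee_fin ler_nat leqNgt.
by apply/negP => /before; apply.
Qed.

Lemma hitting_timeP w :
  (exists m, [/\ hitting_time R Z F w = m%:R%:E, F (Z m w)
    & forall i, (i < m)%N -> ~ F (Z i w)]) \/
  (hitting_time R Z F w = +oo%E /\ forall i, ~ F (Z i w)).
Proof.
have [[k Fk]|never] := pselect (exists k, F (Z k w)).
  left; have ex : exists k, `[< F (Z k w) >] by exists k; apply/asboolP.
  case: (ex_minnP ex) => m /asboolP Fm least; exists m.
  have before i : (i < m)%N -> ~ F (Z i w).
    by rewrite ltnNge => /negP im Fi; apply/im/least/asboolP.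
  by split=> //; exact: hitting_time_least.
right; have none i : ~ F (Z i w) by move=> Fi; apply: never; exists i.
split=> //; rewrite -[RHS]ereal_inf0; congr ereal_inf.
by apply/seteqP; split=> // y [i /none].
Qed.

Lemma lt_hitting_time (a : R) : 0 <= a ->
  [set w | (a%:E < hitting_time R Z F w)%E] = avoids 0 (Num.truncn a).
Proof.
move=> a0; apply/seteqP; split=> w /=.
  case: (hitting_timeP w) => [[m [-> _ before]]|[_ none] _ i _]; last first.
    exact: none.
  rewrite lte_fin => am i /= ia; apply: before.
  by rewrite -(ltr_nat R); apply: le_lt_trans am; rewrite -truncn_ge_nat.
case: (hitting_timeP w) => [[m [-> Fm _]] av|[-> _] _]; last exact: ltry.
rewrite lte_fin ltNge; apply/negP => ma; apply: (av m) Fm.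
by rewrite /= truncn_ge_nat.
Qed.

(** The pathwise form of the formula expressing the mean of a time as the sum of
    its tail probabilities; it also holds when the time is infinite. *)
Lemma hitting_time_series w : hitting_time R Z F w =
  (\sum_(n <oo) (\1_(avoids 0 n) w)%:E)%E.
Proof.
case: (hitting_timeP w) => [[m [-> Fm before]]|[-> none]].
  rewrite (@nneseries_split _ _ 0 m) /=; last by move=> k _; rewrite lee_fin.
  rewrite eseries0 ?adde0 => [|i mi _]; last first.
    by rewrite indicE memNset // => /(_ m); rewrite mi; apply.
  rewrite add0n big_mkord (eq_bigr (fun=> 1%E)).
    by rewrite sumEFin sumr_const card_ord.
  move=> i _; rewrite indicE mem_set // => j /= ji; apply: before.
  exact: leq_ltn_trans ji _.
apply/esym/eqyP => A A0.
apply: le_trans (nneseries_lim_ge (m := 0) (Num.truncn A).+1 _); last first.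
  by move=> k _ _; rewrite lee_fin.
rewrite big_mkord (eq_bigr (fun=> 1%E)).
  by rewrite sumEFin sumr_const card_ord lee_fin ltW // truncnS_gt.
by move=> i _; rewrite indicE mem_set // => j _; exact: none.
Qed.

End HittingTime.

Section MarkovAvoidance.
Variables (R : realType) (d : measure_display) (Omega : measurableType d).
Variables (P : probability Omega R) (St : finType) (p : St -> St -> R).
Variables (x : St) (Z : nat -> Omega -> St).
Hypothesis chain : markov_chain_from P p x Z.

Lemma EFin_prob (A : set Omega) : measurable A -> (prob P A)%:E = P A.
Proof. by move=> mA; rewrite /prob fineK // fin_num_measure. Qed.

Lemma probI_le (A B : set Omega) : measurable A -> measurable B ->
  prob P (A `&` B) <= prob P A.
Proof.
move=> mA mB; have mAB := measurableI _ _ mA mB; rewrite -lee_fin !EFin_prob //.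
by apply: le_measure; rewrite ?inE.
Qed.

Lemma prob_ge0 (A : set Omega) : 0 <= prob P A.
Proof. by rewrite fine_ge0. Qed.

Lemma measurable_state t (A : set St) : measurable (Z t @^-1` A).
Proof.
rewrite (_ : Z t @^-1` A = \bigcup_(y in A) (Z t @^-1` [set y])).
  by apply: fin_bigcup_measurable => // y _; have [] := chain.
apply/seteqP; split=> w /= => [Aw|[y Ay Zy]]; last by rewrite /= Zy.
by exists (Z t w).
Qed.

Lemma measurable_history s n : measurable (history Z s n).
Proof.
rewrite (_ : history Z s n =
  \bigcap_(i in `I_n.+1) (Z i @^-1` [set s i])) //.
by apply: fin_bigcap_measurable => // i _; exact: measurable_state.
Qed.

Lemma measurable_avoids (F : set St) m n : measurable (avoids Z F m n).
Proof.
rewrite (_ : avoids Z F m n =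
  \bigcap_(i in [set i | (m <= i <= n)%N]) (Z i @^-1` ~` F)) //.
by apply: bigcap_measurableType => i _; exact: measurable_state.
Qed.

Lemma prob_partition t (A : set Omega) : measurable A ->
  prob P A = \sum_y prob P (A `&` Z t @^-1` [set y]).
Proof.
move=> mA; apply: EFin_inj; rewrite -sumEFin EFin_prob //.
have mAy y : measurable (A `&` Z t @^-1` [set y]).
  by apply: measurableI => //; exact: measurable_state.
under eq_bigr do rewrite EFin_prob //.
rewrite fsbig_seq ?index_enum_uniq // -measure_fin_bigcup //.
- congr (P _); apply/seteqP; split=> w /=; last by case=> y _ [].
  by move=> Aw; exists (Z t w) => //=; rewrite mem_index_enum.
- apply/trivIsetP => y z _ _ /eqP yz.
  apply/seteqP; split=> // w [[_ /= Zy] [_ /= Zz]].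
  by apply: yz; rewrite -Zy -Zz.
Qed.

(** The product form of the Markov property, valid for null histories too. *)
Lemma prob_history_step s n y :
  prob P (history Z s n `&` Z n.+1 @^-1` [set y]) =
    prob P (history Z s n) * p (s n) y.
Proof.
have [h0|] := eqVneq (prob P (history Z s n)) 0.
  apply/eqP; rewrite h0 mul0r eq_le prob_ge0 andbT -h0.
  by apply: probI_le; [exact: measurable_history | exact: measurable_state].
move=> hn0; have hpos : 0 < prob P (history Z s n).
  by rewrite lt_neqAle eq_sym hn0 prob_ge0.
have [_ _ /(_ n s y hpos) <-] := chain.
by rewrite /condprob mulrC divfK // setIC.
Qed.

(** The Markov property is stated for histories ending at the present, so the
    avoided times are placed after a history of arbitrary length [m]; the
    induction on [n] then lengthens this history by one state. *)
Lemma prob_history_avoids (F : set St) n m s :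
  prob P (history Z s m `&` avoids Z F m (m + n)) =
  prob P (history Z s m) * survival p F n (s m).
Proof.
elim: n m s => [|n IH] m s.
  rewrite addn0 /survival /=; have [smF|smF] := boolP (s m \in F).
    rewrite mulr0 (_ : _ `&` _ = set0) ?/prob ?measure0 //.
    apply/seteqP; split=> // w [hw /(_ m)]; rewrite leqnn => /(_ isT).
    by rewrite (hw m) //; apply; move: smF; rewrite inE.
  rewrite mulr1; congr (prob P _); apply/seteqP; split=> [w []|w hw] //.
  split=> // i; rewrite -eqn_leq => /eqP <-; rewrite (hw m) // => Fs.
  by move/negP: smF; apply; rewrite inE.
have [smF|smF] := boolP (s m \in F).
  rewrite survival_in // mulr0 (_ : _ `&` _ = set0) ?/prob ?measure0 //.
  apply/seteqP; split=> // w [hw /(_ m)]; rewrite leqnn leq_addr => /(_ isT).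
  by rewrite (hw m) //; apply; move: smF; rewrite inE.
rewrite survivalS_notin // mulr_sumr.
rewrite (prob_partition m.+1); last first.
  by apply: measurableI; [exact: measurable_history | exact: measurable_avoids].
apply: eq_bigr => y _.
(* The history [s] up to time [m], continued by the state [y]. *)
pose s' i := if (i <= m)%N then s i else y.
have s'm : s' m.+1 = y by rewrite /s' ltnn.
have hist' : history Z s' m.+1 = history Z s m `&` Z m.+1 @^-1` [set y].
  apply/seteqP; split=> w /=.
    move=> hw; split; last by rewrite /= (hw m.+1).
    by move=> i im; rewrite (hw i (leqW im)) /s' im.
  move=> [hw Zy] i; rewrite leq_eqVlt => /orP[/eqP ->|]; first by rewrite s'm.
  by rewrite ltnS => im; rewrite (hw i im) /s' im.
rewrite mulrA -prob_history_step -hist' -[in RHS]s'm -IH hist'.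
congr (prob P _); apply/seteqP; split=> w /=.
  move=> [[hw av] Zy]; split=> // i /andP[mi im].
  by apply: av; rewrite (ltnW mi) -addSnnS.
move=> [[hw Zy] av]; split=> //; split=> // i /andP[mi im].
move: mi; rewrite leq_eqVlt => /orP[/eqP <-|mi]; last first.
  by apply: av; rewrite mi addSnnS.
by rewrite (hw m) // => Fs; move/negP: smF; apply; rewrite inE.
Qed.

(** [prob_history_avoids] for the history of length zero, which has full
    probability. *)
Lemma prob_avoids (F : set St) n : prob P (avoids Z F 0 n) = survival p F n x.
Proof.
have hist0 : history Z (fun=> x) 0 = Z 0%N @^-1` [set x].
  apply/seteqP; split=> w /= => [/(_ 0%N)|Z0 i]; first exact.
  by rewrite leqn0 => /eqP ->.
have Z0x : prob P (Z 0%N @^-1` [set x]) = 1 by have [] := chain.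
have := prob_history_avoids F n 0 (fun=> x).
rewrite hist0 Z0x mul1r add0n => <-.
rewrite (prob_partition 0); last exact: measurable_avoids.
rewrite (bigD1 x) //= setIC -[RHS]addr0; congr (_ + _).
apply: big1 => y yx; apply/eqP; rewrite eq_le prob_ge0 andbT.
have : prob P (Z 0%N @^-1` [set y]) + prob P (Z 0%N @^-1` [set x]) <= 1.
  rewrite -[leRHS](_ : prob P setT = 1); last first.
    by rewrite /prob probability_setT.
  rewrite (prob_partition 0 measurableT) (bigD1 x) //= (bigD1 y) //=.
  rewrite !setTI addrCA addrA lerDl.
  by apply: sumr_ge0 => z _; exact: prob_ge0.
rewrite Z0x gerDr; apply: le_trans.
rewrite setIC; apply: probI_le; last exact: measurable_avoids.
exact: measurable_state.
Qed.

Lemma prob_lt_hitting_time (F : set St) (a : R) : 0 <= a ->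
  prob P [set w | (a%:E < hitting_time R Z F w)%E] =
  survival p F (Num.truncn a) x.
Proof. by move=> a0; rewrite lt_hitting_time // prob_avoids. Qed.

Lemma measurable_lt_hitting_time (F : set St) (a : R) : 0 <= a ->
  measurable [set w | (a%:E < hitting_time R Z F w)%E].
Proof. by move=> a0; rewrite lt_hitting_time //; exact: measurable_avoids. Qed.

Lemma mean_hitting_time (F : set St) :
  mean P (hitting_time R Z F) = (\sum_(n <oo) (survival p F n x)%:E)%E.
Proof.
rewrite /mean; under eq_integral do rewrite hitting_time_series.
rewrite integral_nneseries //; last first.
  move=> n; apply/measurable_realfun.measurable_EFinP.
  apply: measurable_realfun.measurable_indic; exact: measurable_avoids.
apply: eq_eseriesr => n _; rewrite integral_indic ?setIT //; last first.
  exact: measurable_avoids.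
by rewrite -prob_avoids EFin_prob //; exact: measurable_avoids.
Qed.

End MarkovAvoidance.

(** * Early exponential behaviour *)

Section ChainHitting.
Variables (R : realType) (d : measure_display) (Omega : measurableType d).
Variables (P : probability Omega R) (St : finType) (p : St -> St -> R).
Variables (x : St) (Z : nat -> Omega -> St) (G : set St).
Hypothesis chain : markov_chain_from P p x Z.

Lemma prob_hitting_time_le (a : R) : 0 <= a ->
  prob P [set w | (hitting_time R Z G w <= a%:E)%E] =
  1 - survival p G (Num.truncn a) x.
Proof.
move=> a0; have mA := measurable_lt_hitting_time chain G a0.
rewrite -(prob_lt_hitting_time chain G a0).
rewrite (_ : [set w | _] = ~` [set w | (a%:E < hitting_time R Z G w)%E]).
  apply: EFin_inj; rewrite EFinB !EFin_prob ?probability_setC //.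
  exact: measurableC.
by apply/seteqP; split=> w /=; rewrite leNgt => /negP.
Qed.

Lemma prob_hitting_time_itv (a b : R) : 0 <= a -> a <= b ->
  prob P [set w | (a%:E < hitting_time R Z G w <= b%:E)%E] =
  survival p G (Num.truncn a) x - survival p G (Num.truncn b) x.
Proof.
move=> a0 ab; have b0 := le_trans a0 ab.
have mA := measurable_lt_hitting_time chain G a0.
have mB := measurable_lt_hitting_time chain G b0.
rewrite -(prob_lt_hitting_time chain G a0) -(prob_lt_hitting_time chain G b0).
set A := [set w | (a%:E < _)%E] in mA *.
set B := [set w | (b%:E < _)%E] in mB *.
have BA : B `<=` A by move=> w; apply: le_lt_trans; rewrite lee_fin.
rewrite (_ : [set w | _] = A `\` B); last first.
  apply/seteqP; split=> w /=; rewrite leNgt.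
    by move=> /andP[? /negP].
  by move=> [? ?]; apply/andP; split=> //; apply/negP.
apply: EFin_inj; rewrite EFinB !EFin_prob ?measureD //; last exact: measurableD.
  by rewrite setIidr.
by rewrite ltey_eq fin_num_measure.
Qed.

Hypothesis p_stoch : stochastic p.

(** The mean is finite because, by [uniform_absorption], the tail decays
    geometrically. *)
Lemma mean_hitting_time_total_mass : irreducible p -> G !=set0 ->
  exists2 T : R, mean P (hitting_time R Z G) = T%:E
    & total_mass ((survival p G)^~ x) T.
Proof.
move=> irr G0; rewrite (mean_hitting_time chain).
set f := (survival p G)^~ x.
have f_ge0 n : 0 <= f n by exact: survival_ge0.
have partialE j : (\sum_(0 <= n < j) (f n)%:E = (\sum_(n < j) f n)%:E)%E.
  by rewrite big_mkord sumEFin.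
have le_bound B : (forall j, \sum_(n < j) f n <= B) ->
    (\sum_(n <oo) (f n)%:E <= B%:E)%E.
  move=> ubB; apply: lime_le.
    by apply: is_cvg_nneseries => n _ _; rewrite lee_fin.
  by apply: nearW => j; rewrite partialE lee_fin.
have [m [q [q0 q1 le_q]]] := uniform_absorption p_stoch irr G0.
have decay n : f (n + m)%N <= q * f n by exact: survival_geometric.
have bounded j : \sum_(n < j) f n <= m%:R / (1 - q).
  have f_le1 n : f n <= 1 by exact: survival_le1.
  have := partial_sum_le_of_decay f_ge0 f_le1 q0 decay j.
  rewrite ler_pdivlMr ?subr_gt0 // mulrBr mulr1 lerBlDr.
  by rewrite (mulrC q).
have sum_fin : (\sum_(n <oo) (f n)%:E)%E \is a fin_num.
  rewrite ge0_fin_numE; last by apply: nneseries_ge0 => n _ _; rewrite lee_fin.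
  by apply: le_lt_trans (le_bound _ bounded) _; rewrite ltry.
exists (fine (\sum_(n <oo) (f n)%:E)%E); first by rewrite fineK.
split=> [j|B ubB]; rewrite -lee_fin fineK ?le_bound // -partialE.
by apply: nneseries_lim_ge => n _ _; rewrite lee_fin.
Qed.

End ChainHitting.

Lemma rec_survival_le (R : realType) (d : measure_display)
    (Omega : measurableType d) (P : probability Omega R) (St : finType)
    (p : St -> St -> R) (X : St -> nat -> Omega -> St) (x0 : St) (G : set St)
    (rho r : R) : (forall x, markov_chain_from P p x (X x)) -> 0 <= rho ->
  Rec P X x0 G rho r ->
  forall x, survival p (x0 |` G) (Num.truncn rho) x <= r.
Proof.
move=> chains rho0 rec x; rewrite -(prob_lt_hitting_time (chains x)) //.
rewrite -lee_fin EFin_prob //; last first.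
  exact: (measurable_lt_hitting_time (chains x)).
by apply: le_trans rec; apply: ereal_sup_ubound; exists x.
Qed.

Lemma early_exponential_hitting_time (R : realType) (d : measure_display)
    (Omega : measurableType d) (P : probability Omega R) (St : finType)
    (p : St -> St -> R) (X : St -> nat -> Omega -> St) (x0 : St) (G : set St)
    (rho r eta : R) (tau := hitting_time R (X x0) G)
    (T := fine (mean P tau)) (eps := rho / T) :
  irreducible_markov_chain P p X -> G !=set0 ->
  1 <= rho -> (rho%:E < mean P tau)%E -> 0 < r -> Rec P X x0 G rho r ->
  0 < eta -> eta <= 1 -> eps / eta <= 1 / 2000 -> r / eta <= 1 / 2000 ->
  early_exponential P tau (eta * T) (1000 * (eps / eta + r / eta)).
Proof.
move=> [p_stoch irr chains] G0 rho1 rhoT r0 rec eta0 eta1 eps_eta r_eta.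
have [T' meanT T_total] :=
  mean_hitting_time_total_mass (chains x0) p_stoch irr G0.
have TT' : T = T' by rewrite /T /tau meanT.
rewrite /tau meanT -TT' lte_fin in rhoT; rewrite -TT' in T_total meanT.
have T0 : 0 < T by apply: lt_trans rhoT; exact: lt_le_trans rho1.
have rho0 : 0 <= rho := le_trans ler01 rho1.
have S0 : 0 <= eta * T by rewrite mulr_ge0 ?(ltW eta0) ?(ltW T0).
set f := (survival p G)^~ x0 in T_total.
have f0 : f 0%N = 1.
  rewrite /f /survival /=; have [x0G|//] := boolP (x0 \in G).
  have : T <= 0.
    by apply: T_total.2 => j; rewrite big1 // => n _; exact: survival_in.
  by rewrite leNgt T0.
have recN := rec_survival_le chains rho0 rec.
have N_le : (Num.truncn rho)%:R <= eps * T.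
  by rewrite /eps divfK ?gt_eqF // truncn_le.
(* Both hypotheses on [eta] contribute [eta / 2000]. *)
have small : eps + r <= eta / 1000.
  rewrite ler_pdivrMr // in eps_eta; rewrite ler_pdivrMr // in r_eta.
  by move: eps_eta r_eta; clear; lra.
have N0 : (0 < Num.truncn rho)%N by rewrite truncn_gt0.
have f_ge0 n : 0 <= f n by exact: survival_ge0.
have f_mono : {homo f : m n / (m <= n)%N >-> n <= m} by exact: survival_mono.
split; first by rewrite /tau meanT lee_fin ler_piMl // ltW.
move=> k; rewrite /tau meanT lee_fin => kS_le.
have keta : k%:R * eta <= 1 by rewrite -(ler_pM2r T0) mul1r -mulrA.
have [f_neq0 f_neq1 ratio] := early_tail_increments f0 f_ge0 f_mono
  (tail_le_renew p_stoch recN) (tail_ge_renew p_stoch recN) T_total N0 T0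
  N_le r0 eta0 eta1 small keta.
have kS_ge0 : 0 <= k%:R * (eta * T) by rewrite mulr_ge0.
rewrite (prob_lt_hitting_time (chains x0)) //.
rewrite (prob_hitting_time_le _ (chains x0)) //.
rewrite (prob_hitting_time_itv _ (chains x0)) // ?ler_wpM2r ?ler_nat //.
split; first by rewrite mulf_neq0 // expf_neq0.
by rewrite -mulrDl.
Qed.

Theorem theorem2p13 (R : realType) :
  exists K kappa : R,
    [/\ 0 < kappa < 1,
        forall (d : measure_display) (Omega : measurableType d)
          (P : probability Omega R) (St : finType) (p : St -> St -> R)
          (X : St -> nat -> Omega -> St) (x0 : St) (G : set St)
          (rho r eta : R),
          let tau : Omega -> \bar R := hitting_time R (X x0) G in
          let T : R := fine (mean P tau) in
          let eps : R := rho / T in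
          irreducible_markov_chain P p X ->
          G !=set0 ->
          1 <= rho -> (rho%:E < mean P tau)%E ->
          0 < r < 1 ->
          Rec P X x0 G rho r ->
          eps <= kappa -> r <= kappa ->
          0 < eta < 1 ->
          eps / eta <= kappa -> r / eta <= kappa ->
          early_exponential P tau (eta * T) (K * (eps / eta + r / eta))
      & forall gamma : R, gamma < 1 ->
        exists2 delta : R, 0 < delta &
        forall (d : measure_display) (Omega : measurableType d)
          (P : probability Omega R) (St : finType) (p : St -> St -> R)
          (X : St -> nat -> Omega -> St) (x0 : St) (G : set St)
          (rho r : R),
          let tau : Omega -> \bar R := hitting_time R (X x0) G in
          let T : R := fine (mean P tau) in
          let eps : R := rho / T in
          let eta : R := (Num.max eps r) `^ gamma in
          irreducible_markov_chain P p X ->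
          G !=set0 ->
          1 <= rho -> (rho%:E < mean P tau)%E ->
          0 < r < 1 ->
          Rec P X x0 G rho r ->
          eps <= delta -> r <= delta ->
          0 < eta < 1 ->
          early_exponential P tau (eta * T) (K * (eps / eta + r / eta))].
Proof.
(* An opaque name keeps the numeral [2000] out of unification. *)
have [kappa kappaE] : exists kappa : R, kappa = 1 / 2000 by eexists.
have kappa_gt0 : 0 < kappa by rewrite kappaE; clear; lra.
have kappa_lt1 : kappa < 1 by rewrite kappaE; clear; lra.
exists 1000, kappa; split; first by rewrite kappa_gt0.
  move=> d Omega P St p X x0 G rho r eta tau T eps chain G0 rho1 rhoT.
  move=> /andP[r0 _] rec _ _ /andP[eta0 eta1] eps_eta r_eta.
  rewrite kappaE in eps_eta r_eta.
  exact: (early_exponential_hitting_time chain G0 rho1 rhoT r0 rec eta0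
    (ltW eta1)).
move=> gamma gamma1; have g1 : 0 < 1 - gamma by rewrite subr_gt0.
(* [delta] is chosen so that [delta `^ (1 - gamma) = kappa]. *)
exists (kappa `^ (1 - gamma)^-1); first exact: powR_gt0.
move=> d Omega P St p X x0 G rho r tau T eps eta chain G0 rho1 rhoT.
move=> /andP[r0 _] rec eps_le r_le /andP[eta0 eta1].
set M := Num.max eps r; have M0 : 0 < M by rewrite lt_max r0 orbT.
have M_eta : M / eta <= kappa.
  rewrite /eta -/M -{1}(powRr1 (ltW M0)) -powRB ?gt_eqF //.
  have -> : kappa = (kappa `^ (1 - gamma)^-1) `^ (1 - gamma).
    by rewrite -powRrM mulVf ?gt_eqF // powRr1 ?(ltW kappa_gt0).
  apply: ge0_ler_powR; rewrite ?nnegrE ?powR_ge0 ?(ltW g1) ?(ltW M0) //.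
  by rewrite ge_max eps_le.
have le_M y : y <= M -> y / eta <= kappa.
  by move=> yM; apply: le_trans M_eta; rewrite ler_pM2r ?invr_gt0.
apply: (early_exponential_hitting_time chain G0 rho1 rhoT r0 rec eta0
  (ltW eta1)).
- by rewrite -kappaE; apply: le_M; rewrite le_max lexx.
- by rewrite -kappaE; apply: le_M; rewrite le_max lexx orbT.
Qed.
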